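(* Let $\{S^n\}_{n\in\mathbb{N}}$ be an $\mathbb{R}^h$-valued process of integrable random variables that is strongly regular and strongly nearly additive, and suppose $\sup_{n\in\mathbb{N}}\|\mathbb{E}[S^n]\|/|\Lambda^n|<\infty$. Then the limit $\widehat S=\lim_{n\to\infty}\mathbb{E}[S^n]/|\Lambda^n|$ exists in $\mathbb{R}^h$ and $S^n/|\Lambda^n|\to\widehat S$ almost surely as $n\to\infty$.
   Context: Fix $d,h\in\mathbb{N}$, $|\Lambda^n|=(2n)^d$, $\|\cdot\|$ Euclidean norm. Strongly $r$-nearly additive (integer $r\ge0$): there exist $\mathbb{R}^h$-valued random variables $\{S^{n,z}\}_{n\in\mathbb{N},z\in\mathbb{Z}^d}$ with $\{S^{n,z}\}_{z\in\mathbb{Z}^d}$ independent copies of $S^n$ for each $n$, such that $\sup_{m\in\mathbb{N}}|\Lambda^{(2m+1)k}|^{-1}\|S^{(2m+1)k}-\sum_{z\in\mathbb{Z}^d\cap[-m,m]^d}S^{k-r,z}\|\to0$ almost surely as $k\to\infty$; strongly nearly additive = strongly $r$-nearly additive for some $r$. Strongly regular: for each fixed $k\in\mathbb{N}$, with $m_n$ the integer satisfying $(2m_n+1)k\le n<(2m_n+3)k$, $|\Lambda^n|^{-1}\|S^n-S^{(2m_n+1)k}\|\to0$ almost surely as $n\to\infty$. *)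

(* Defs.v *)
From HB Require Import structures.
From mathcomp Require Import all_boot all_order all_algebra.
From mathcomp Require Import all_classical all_reals all_analysis.
Set Implicit Arguments. Unset Strict Implicit. Unset Printing Implicit Defensive.
Import Order.TTheory GRing.Theory Num.Theory.
Import numFieldNormedType.Exports.
Local Open Scope classical_set_scope.
Local Open Scope ring_scope.

Definition latt (d : nat) := {ffun 'I_d -> int}.

Definition enorm (R : realType) (h : nat) (v : 'rV[R]_h) : R :=
  Num.sqrt (\sum_(i < h) (v ord0 i) ^+ 2).

Definition vol (R : realType) (d n : nat) : R := ((2 * n) ^ d)%:R.

Definition borel_vec (R : realType) (h : nat) : set (set 'rV[R]_h) :=
  <<s (fun C : set 'rV[R]_h => exists (i : 'I_h) (A : set R),
          measurable A /\ C = [set v | A (v ord0 i)]) >>.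

Definition random_vec (dm : measure_display) (T : measurableType dm)
  (R : realType) (h : nat) (X : T -> 'rV[R]_h) : Prop :=
  forall i : 'I_h, measurable_fun setT (fun w => X w ord0 i).

Definition integrable_vec (dm : measure_display) (T : measurableType dm)
  (R : realType) (P : probability T R) (h : nat) (X : T -> 'rV[R]_h) : Prop :=
  forall i : 'I_h, P.-integrable setT (fun w => (X w ord0 i)%:E).

Definition expect (dm : measure_display) (T : measurableType dm)
  (R : realType) (P : probability T R) (h : nat) (X : T -> 'rV[R]_h) : 'rV[R]_h :=
  \row_(i < h) Rintegral P setT (fun w => X w ord0 i).

Definition same_law (dm : measure_display) (T : measurableType dm)
  (R : realType) (P : probability T R) (h : nat) (X Y : T -> 'rV[R]_h) : Prop :=
  forall B, borel_vec B -> P (X @^-1` B) = P (Y @^-1` B).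

Definition indep_vecs (dm : measure_display) (T : measurableType dm)
  (R : realType) (P : probability T R) (h : nat) (I : eqType)
  (X : I -> T -> 'rV[R]_h) : Prop :=
  forall (J : seq I) (B : I -> set 'rV[R]_h), uniq J ->
    (forall i, borel_vec (B i)) ->
    P (\bigcap_(i in [set j | j \in J]) (X i @^-1` B i)) =
    (\prod_(i <- J) P (X i @^-1` B i))%E.

Definition box_sum (R : realType) (h d m : nat) (F : latt d -> 'rV[R]_h)
  : 'rV[R]_h :=
  \sum_(t : {ffun 'I_d -> 'I_(2 * m + 1)})
     F [ffun i => (nat_of_ord (t i))%:Z - m%:Z].

Definition strongly_r_nearly_additive (dm : measure_display)
  (T : measurableType dm) (R : realType) (P : probability T R) (d h : nat)
  (S : nat -> T -> 'rV[R]_h) (r : nat) : Prop :=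
  exists Sz : nat -> latt d -> T -> 'rV[R]_h,
    (forall n z, random_vec (Sz n z)) /\
    (forall n, indep_vecs P (Sz n)) /\
    (forall n z, same_law P (Sz n z) (S n)) /\
    {ae P, forall w,
      forall e : R, 0 < e -> \forall k \near \oo,
        forall m : nat, (0 < m)%N ->
          (vol R d ((2 * m + 1) * k))^-1 *
            enorm (S ((2 * m + 1) * k) w
                   - box_sum m (fun z => Sz (k - r)%N z w)) <= e}.

Definition strongly_nearly_additive (dm : measure_display)
  (T : measurableType dm) (R : realType) (P : probability T R) (d h : nat)
  (S : nat -> T -> 'rV[R]_h) : Prop :=
  exists r : nat, strongly_r_nearly_additive P d S r.

Definition strongly_regular (dm : measure_display)
  (T : measurableType dm) (R : realType) (P : probability T R) (d h : nat)
  (S : nat -> T -> 'rV[R]_h) : Prop :=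
  forall k : nat, (0 < k)%N ->
    {ae P, forall w,
      forall e : R, 0 < e -> \forall n \near \oo,
        forall m : nat, ((2 * m + 1) * k <= n < (2 * m + 3) * k)%N ->
          (vol R d n)^-1 * enorm (S n w - S ((2 * m + 1) * k)%N w) <= e}.

(* Main.v *)
(* For fixed k, the strong law of large numbers along the boxes [-m, m]^d shows
   that the box averages of the i.i.d. field S^{k-r,z} converge almost surely to
   E[S^{k-r}].  Near additivity and regularity then force, almost surely, every
   cluster point of S^n / |L^n| to lie within eps_k of E[S^{k-r}] / |L^k|, where
   eps_k -> 0.  So S^n / |L^n| is Cauchy, and its limit is that of the
   deterministic sequence E[S^{k-r}] / |L^k|.

   The strong law for integrable variables comes from the maximal ergodic lemma:
   if c > E[X_0], the event A that the partial sums of X_i - c are unbounded above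
   satisfies \int_A (X_0 - c) >= 0.  Being shift invariant, A depends on
   X_1, X_2, ... only, hence is independent of X_0, so that
   (E[X_0] - c) P(A) >= 0 and P(A) = 0. *)
Require Import Defs.
From HB Require Import structures.
From mathcomp Require Import all_boot all_order all_algebra.
From mathcomp Require Import all_classical all_reals all_analysis.
From mathcomp Require Import measurable_realfun ring lra zify.
Import Order.TTheory GRing.Theory Num.Theory.
Import numFieldNormedType.Exports.
Local Open Scope classical_set_scope.
Local Open Scope ring_scope.
Set Implicit Arguments. Unset Strict Implicit. Unset Printing Implicit Defensive.

(** * Maximal ergodic lemma for a measure-preserving map *)

(* The maximum of [0] and the first [n] Birkhoff sums of [f] along [th]. *)
Fixpoint psmax (R : realDomainType) (T : Type) (th : T -> T) (f : T -> R) (n : nat) (x : T) : R :=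
  if n is n'.+1 then Num.max 0 (f x + psmax th f n' (th x)) else 0.

Lemma psmax_ge0 (R : realDomainType) (T : Type) (th : T -> T) (f : T -> R) n x :
  0 <= psmax th f n x.
Proof. by case: n => //= n; rewrite le_max lexx. Qed.

Lemma psmax_nd (R : realDomainType) (T : Type) (th : T -> T) (f : T -> R) n x :
  psmax th f n x <= psmax th f n.+1 x.
Proof.
elim: n x => [|n IHn] x; first exact: psmax_ge0.
rewrite [leLHS]/= [leRHS]/= ge_max; apply/andP; split; rewrite le_max ?lexx//.
by rewrite lerD2l IHn orbT.
Qed.

Lemma psmax_homo (R : realDomainType) (T : Type) (th : T -> T) (f : T -> R) x :
  {homo (fun n => psmax th f n x) : m n / (m <= n)%N >-> m <= n}.
Proof. by apply: homo_leq; [exact: lexx|exact: le_trans|move=> n; exact: psmax_nd]. Qed.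

Section maximal.
Context d (T : measurableType d) (R : realType) (mu : {measure set T -> \bar R}).
Variables (th : T -> T) (f : T -> R).
Hypothesis mth : measurable_fun setT th.
Hypothesis muth : forall A, measurable A -> mu (th @^-1` A) = mu A.
Hypothesis intf : mu.-integrable setT (EFin \o f).

(** Natural thresholds exhibit the event as a countable intersection of countable unions, hence as a
    measurable set. *)
Definition psmax_unbounded : set T :=
  [set x | forall K : nat, exists n, K%:R < psmax th f n x].

Let mf : measurable_fun setT f.
Proof. by apply/measurable_EFinP; exact: measurable_int intf. Qed.

Lemma measurable_psmax n : measurable_fun setT (psmax th f n).
Proof.
elim: n => [|n IHn] /=; first exact: measurable_cst.
apply: measurable_maxr; first exact: measurable_cst.
apply: measurable_funD => //.
exact: measurableT_comp.
Qed.

Lemma measurable_psmax_unbounded : measurable psmax_unbounded.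
Proof.
rewrite (_ : psmax_unbounded =
  \bigcap_(K in setT) \bigcup_(n in setT) [set x | K%:R < psmax th f n x]); last first.
  apply/seteqP; split => [x Ax K _|x Ax K].
    by have [n] := Ax K; exists n.
  by have [n _] := Ax K I; exists n.
apply: bigcapT_measurable => K; apply: bigcupT_measurable => n.
rewrite -[X in measurable X]setTI.
rewrite (_ : [set x | _] = psmax th f n @^-1` `]K%:R, +oo[%classic); last first.
  by apply/seteqP; split => x /=; rewrite in_itv/= andbT.
by apply: measurable_psmax.
Qed.

(** Up to truncation at [0], the maxima at [x] and at [th x] differ by [f x], so raising the
    threshold by a constant depending on [x] passes from one orbit to the other. *)
Lemma psmax_unbounded_invariant : th @^-1` psmax_unbounded = psmax_unbounded.
Proof.
apply/seteqP; split => x /= Ax K.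
  have [n] := Ax (Num.truncn `|K%:R - f x|).+1.
  move=> nx; exists n.+1; rewrite /= lt_max; apply/orP; right.
  rewrite -ltrBlDl (le_lt_trans _ nx)// (le_trans (ler_norm _))//.
  by rewrite ltW// Num.Theory.truncnS_gt.
have [n] := Ax (Num.truncn `|K%:R + f x|).+1.
case: n => [|n] /=; first by rewrite ltNge ler0n.
rewrite lt_max ltNge ler0n/= => nx.
exists n; move: nx; rewrite -ltrBlDl => /(le_lt_trans _); apply.
rewrite lerBrDr (le_trans (ler_norm _))//.
by rewrite ltW// Num.Theory.truncnS_gt.
Qed.

Lemma le_psmax_abs n x : psmax th f n.+1 x <= `|f x| + psmax th f n (th x).
Proof.
rewrite /= ge_max addr_ge0 ?psmax_ge0//=.
by rewrite lerD2r ler_norm.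
Qed.

(** Provides the dominating function [|f|] for dominated convergence. *)
Lemma psmax_increment_le n x : `|psmax th f n.+1 x - psmax th f n (th x)| <= `|f x|.
Proof.
rewrite ler_norml; apply/andP; split; last by rewrite lerBlDr le_psmax_abs.
rewrite lerBrDr /= le_max; apply/orP; right.
by rewrite lerD2r lerNl (le_trans (ler_norm _))// normrN.
Qed.

Lemma integral_comp_invariant (D : set T) (g : T -> \bar R) : measurable D ->
  measurable_fun D g -> (forall x, 0 <= g x)%E ->
  (\int[mu]_(x in th @^-1` D) g (th x) = \int[mu]_(x in D) g x)%E.
Proof.
move=> mD mg g0.
transitivity (\int[pushforward mu th]_(x in D) g x)%E.
  by rewrite ge0_integral_pushforward.
by apply: eq_measure_integral => A mA _; exact: muth.
Qed.

Lemma integrable_comp_invariant (g : T -> R) :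
  mu.-integrable setT (EFin \o g) -> mu.-integrable setT (EFin \o (g \o th)).
Proof.
move=> /integrableP[/measurable_EFinP mg ig]; apply/integrableP; split.
  by apply/measurable_EFinP; exact: measurableT_comp.
have := @integral_comp_invariant setT (fun x => `|(g x)%:E|)%E measurableT.
by rewrite preimage_setT /= => ->//; apply/measurable_EFinP; exact: measurableT_comp.
Qed.

Lemma integrable_psmax n : mu.-integrable setT (EFin \o psmax th f n).
Proof.
elim: n => [|n IHn]; first exact: integrable0.
apply: (le_integrable measurableT _ _
  (integrableD measurableT (integrable_norm intf) (integrable_comp_invariant IHn))).
  by apply/measurable_EFinP; exact: measurable_psmax.
move=> x _; rewrite /comp abse_EFin [X in (_ <= X)%E]/= lee_fin.
rewrite ger0_norm ?psmax_ge0// ger0_norm ?addr_ge0 ?psmax_ge0//.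
exact: le_psmax_abs.
Qed.

(* [psmax th f n.+1 - psmax th f n \o th] has nonnegative integral over the
   invariant set, and tends there to [f] by domination. *)
Lemma integral_psmax_unbounded_ge0 :
  (0 <= \int[mu]_(x in psmax_unbounded) (f x)%:E)%E.
Proof.
have mA := measurable_psmax_unbounded.
set A := psmax_unbounded in mA *.
have iA g : mu.-integrable setT g -> mu.-integrable A g.
  by move=> ig; exact: (integrableS measurableT).
pose g n x := psmax th f n.+1 x - psmax th f n (th x).
have mg n : measurable_fun setT (g n).
  apply: measurable_funB; first exact: measurable_psmax.
  by apply: measurableT_comp => //; exact: measurable_psmax.
have [||||_ _ cvgint] := @dominated_convergence _ _ _ mu A mA
    (fun n x => (g n x)%:E) (EFin \o f) (EFin \o (Num.norm \o f)) _ _ _ (iA _ (integrable_norm intf)).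
- by move=> n; apply/measurable_EFinP; exact: measurable_funTS.
- by apply/measurable_EFinP; exact: measurable_funTS.
- apply/aeW => x; rewrite /A -psmax_unbounded_invariant => Ax.
  (* Since [th x] lies in [A], the maxima at [th x] eventually exceed [|f x|]; the maximum with [0]
     is then inactive and the increment equals [f x]. *)
  apply: cvg_near_cst.
  have [N hN] := Ax (Num.truncn `|f x|).+1.
  near=> n.
  have nN : (N <= n)%N by near: n; exact: nbhs_infty_ge.
  rewrite /g /=; congr EFin.
  rewrite max_r ?addrK//.
  rewrite -lerBlDl sub0r (le_trans _ (psmax_homo th f (th x) nN))//.
  rewrite (le_trans _ (ltW hN))// (le_trans (ler_norm _))// ltW// normrN.
  by rewrite Num.Theory.truncnS_gt.
- by apply/aeW => x n _; rewrite /= lee_fin psmax_increment_le.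
rewrite -(cvg_lim _ cvgint)//.
apply: lime_ge; first by apply/cvg_ex; eexists; exact: cvgint.
apply: nearW => n.
have in1 := iA _ (integrable_psmax n.+1).
have inth := iA _ (integrable_comp_invariant (integrable_psmax n)).
change (0 <= \int[mu]_(x in A)
  ((EFin \o psmax th f n.+1) \- (EFin \o (psmax th f n \o th))) x)%E.
rewrite integralB// sube_ge0; last first.
  by apply/orP; right; exact: integrable_fin_num.
(* Invariance of both [mu] and [A] removes [th] from the second integral; monotonicity in [n] then
   gives the sign. *)
rewrite (_ : \int[mu]_(x in A) _ = \int[mu]_(x in A) (psmax th f n x)%:E)%E; last first.
  rewrite -[RHS]integral_comp_invariant//; last 2 first.
    by apply/measurable_EFinP/measurable_funTS; exact: measurable_psmax.
    by move=> x; rewrite lee_fin psmax_ge0.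
  by rewrite /A psmax_unbounded_invariant.
apply: le_integral => //; first exact: iA (integrable_psmax n).
by move=> x _; rewrite lee_fin; exact: psmax_nd.
Unshelve. all: by end_near. Qed.


End maximal.

(** * Integrals over an event independent of the integrand *)

(* The measure structure of [pushforward mu f] is inferred up to a proof of
   measurability; this packs both. *)
Definition pushmeasure d1 d2 (T1 : measurableType d1) (T2 : measurableType d2)
    (R : realType) (mu : {measure set T1 -> \bar R}) (f : T1 -> T2)
    (mf : measurable_fun setT f) : {measure set T2 -> \bar R} :=
  measure_function_pushforward__canonical__measure_function_Measure mu mf.
Arguments pushmeasure {d1 d2 T1 T2 R} mu {f} mf.

(** Independence says that the image under [Y] of [P] restricted to [E] is [P E] times the law of
    [Y]; both sides integrate [g] against this measure. *)
Lemma ge0_integral_indep d (T : measurableType d) (R : realType)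
    (P : probability T R) (E : set T) (Y : T -> R) (g : R -> \bar R) :
  measurable E -> measurable_fun setT Y -> measurable_fun setT g ->
  (forall x, 0 <= g x)%E ->
  (forall B, measurable B -> P (E `&` Y @^-1` B) = P E * P (Y @^-1` B))%E ->
  (\int[P]_(w in E) g (Y w) = P E * \int[P]_w g (Y w))%E.
Proof.
move=> mE mY mg g0 indep.
have mgY : measurable_fun setT (fun w => g (Y w)) by exact: measurableT_comp.
have fE : P E \is a fin_num by exact: fin_num_measure.
have fE0 : 0 <= fine (P E) by rewrite fine_ge0.
transitivity (\int[mrestr P mE]_w g (Y w))%E.
  rewrite [RHS](@ge0_negligible_integral _ _ _ _ setT (~` E))//; last 2 first.
    exact: measurableC.
    by rewrite /= /mrestr setICl measure0.
  rewrite setTD setCK; apply: eq_measure_integral => A mA AE.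
  by rewrite /= /mrestr (setIidl AE).
transitivity (\int[mscale (NngNum fE0) (pushmeasure P mY)]_y g y)%E.
  transitivity (\int[pushforward (mrestr P mE) Y]_y g y)%E.
    by rewrite ge0_integral_pushforward.
  apply: eq_measure_integral => A mA _ /=.
  by rewrite /pushforward /mscale /mrestr /= fineK// setIC indep.
rewrite ge0_integral_mscale//= fineK//; congr (_ * _)%E.
by rewrite ge0_integral_pushforward.
Qed.

(** The nonnegative case applies to the positive and negative parts; integrability allows the
    product to distribute over their difference. *)
Lemma integral_indep d (T : measurableType d) (R : realType)
    (P : probability T R) (E : set T) (Y : T -> R) :
  measurable E -> P.-integrable setT (EFin \o Y) ->
  (forall B, measurable B -> P (E `&` Y @^-1` B) = P E * P (Y @^-1` B))%E ->
  (\int[P]_(w in E) (Y w)%:E = P E * \int[P]_w (Y w)%:E)%E.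
Proof.
move=> mE iY indep.
have mY : measurable_fun setT Y by apply/measurable_EFinP; exact: measurable_int iY.
rewrite integralE [X in (_ = P E * X)%E]integralE.
have fE : P E \is a fin_num by exact: fin_num_measure.
rewrite muleBr//; last first.
  by apply: fin_num_adde_defl; rewrite fin_numN; exact: integrable_neg_fin_num.
have mg : measurable_fun [set: R] (EFin \o @id R).
  by apply/measurable_EFinP; exact: measurable_id.
have pos : measurable_fun setT ((EFin \o @id R)^\+)%E by exact: measurable_funepos.
have neg : measurable_fun setT ((EFin \o @id R)^\-)%E by exact: measurable_funeneg.
have e1 : (fun w => (Y w)%:E)^\+%E = (fun w => (EFin \o @id R)^\+%E (Y w)).
  by apply/funext => w; rewrite !funeposE.
have e2 : (fun w => (Y w)%:E)^\-%E = (fun w => (EFin \o @id R)^\-%E (Y w)).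
  by apply/funext => w; rewrite !funenegE.
by rewrite e1 e2 -!ge0_integral_indep.
Qed.

(** * The space of real sequences and its cylinder sigma-algebra *)

(** Rectangles on initial coordinates form a pi-system, and they are the events whose probability an
    i.i.d. hypothesis prescribes. *)
Definition cylinders (R : realType) : set (set (nat -> R)) :=
  [set C | exists (n : nat) (B : nat -> set R), (forall i, measurable (B i)) /\
     C = [set x | forall i, (i < n)%N -> B i (x i)]].

Arguments cylinders : clear implicits.

Notation seqspace R := (g_sigma_algebraType (cylinders R)).

Lemma cylinders_setI (R : realType) : setI_closed (cylinders R).
Proof.
move=> _ _ [m [B [mB ->]]] [n [C [mC ->]]].
exists (maxn m n), (fun i => (if (i < m)%N then B i else setT) `&`
  (if (i < n)%N then C i else setT)); split.
  by move=> i; apply: measurableI; case: ifP.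
apply/seteqP; split => [x [/= xB xC] i _|x /= xBC].
  split.
    by case: ifP => // im'; exact: xB.
  by case: ifP => // im'; exact: xC.
split => i im.
  by have [] := xBC i; rewrite ?leq_max im.
by have [] := xBC i; rewrite ?leq_max im ?orbT.
Qed.

Lemma cylinders_setT (R : realType) : cylinders R setT.
Proof. by exists 0%N, (fun _ => setT); split => //; apply/seteqP; split. Qed.

Lemma measurable_to_seqspace d (T : measurableType d) (R : realType)
    (Y : T -> seqspace R) :
  (forall i, measurable_fun setT (fun w => Y w i)) -> measurable_fun setT Y.
Proof.
move=> mY; apply: (@measurability _ _ T (seqspace R) setT Y (cylinders R)) => //.
move=> _ [_ [n [B [mB ->]]] <-].
rewrite setTI (_ : _ @^-1` _ = \bigcap_(i in [set i | (i < n)%N]) ((fun w => Y w i) @^-1` B i)).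
  apply: bigcap_measurableType => i _.
  by rewrite -[X in measurable X]setTI; exact: mY.
by apply/seteqP; split.
Qed.

Lemma measurable_coord (R : realType) i :
  measurable_fun setT (fun x : seqspace R => x i).
Proof.
move=> _ B mB; rewrite setTI; apply: sub_sigma_algebra.
exists i.+1, (fun j => if j == i then B else setT); split.
  by move=> j; case: ifP.
apply/seteqP; split => [x /= Bx j _|x /= /(_ i (ltnSn i))]; last by rewrite eqxx.
by case: eqP => // ->.
Qed.

Definition seqshift (R : realType) (x : seqspace R) : seqspace R := fun i => x i.+1.
Arguments seqshift {R}.

Lemma measurable_seqshift (R : realType) : measurable_fun setT (@seqshift R).
Proof. by apply: measurable_to_seqspace => i; exact: measurable_coord. Qed.

(** Uniqueness of measures on a pi-system; the whole space is a cylinder of finite measure, so the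
    constant sequence [setT] is the required exhaustion. *)
Lemma eq_measure_cylinders (R : realType)
    (m1 m2 : {measure set (seqspace R) -> \bar R}) :
  (m1 setT < +oo)%E -> (forall C, cylinders R C -> m1 C = m2 C) ->
  forall A, measurable A -> m1 A = m2 A.
Proof.
move=> m1oo m12 A mA.
apply: (@measure_unique _ R (seqspace R) (cylinders R) (fun=> setT) _ _ _ _ m1 m2 _ _ A) => //.
- exact: cylinders_setI.
- by move=> _; exact: cylinders_setT.
- by rewrite bigcup_const//; exists 0%N.
Qed.

(** * The strong law of large numbers for i.i.d. integrable variables *)

Section iid.
Context d (T : measurableType d) (R : realType) (P : probability T R).
Variable X : nat -> T -> R.
Hypothesis mX : forall i, measurable_fun setT (X i).
(** Independence and equality of laws in one formula: taking all sets but one equal to [setT] gives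
    the latter. *)
Hypothesis iid : forall n (B : nat -> set R), (forall i, measurable (B i)) ->
  P [set w | forall i, (i < n)%N -> B i (X i w)] =
  (\prod_(i < n) P (X 0%N @^-1` B i))%E.

Let Xs : T -> seqspace R := fun w i => X i w.

Let mXs : measurable_fun setT Xs.
Proof. by apply: measurable_to_seqspace => i; exact: mX. Qed.

Let mXs' : measurable_fun setT (seqshift \o Xs).
Proof. by apply: measurableT_comp => //; exact: measurable_seqshift. Qed.

(** Singling out the first variable serves twice: [B0 = setT] yields the law of the shifted
    sequence, a general [B0] its independence from [X 0]. *)
Lemma iid_cons n (B0 : set R) (B : nat -> set R) : measurable B0 ->
  (forall i, measurable (B i)) ->
  P [set w | B0 (X 0%N w) /\ forall i, (i < n)%N -> B i (X i.+1 w)] =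
  (P (X 0%N @^-1` B0) * \prod_(i < n) P (X 0%N @^-1` B i))%E.
Proof.
move=> mB0 mB; pose B' i := if i is i'.+1 then B i' else B0.
have := @iid n.+1 B'; rewrite big_ord_recl => <-; last by case.
congr (P _); apply/seteqP; split => [w /= [w0 wB] [|i]// ?|w /= wB]; first exact: wB.
split; first exact: (wB 0%N).
by move=> i ni; exact: (wB i.+1).
Qed.

(** Checked on cylinders; this is the invariance that the maximal ergodic lemma asks of the law of
    the sequence. *)
Lemma iid_stationary (A : set (seqspace R)) : measurable A ->
  P (Xs @^-1` (seqshift @^-1` A)) = P (Xs @^-1` A).
Proof.
move=> mA.
apply: (@eq_measure_cylinders _ (pushmeasure P mXs') (pushmeasure P mXs)) => //.
  by rewrite /= /pushforward preimage_setT probability_setT ltry.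
move=> _ [n [B [mB ->]]]; rewrite /= /pushforward.
rewrite [RHS]iid//.
have := @iid_cons n setT B measurableT mB.
rewrite preimage_setT probability_setT mul1e => <-; congr (P _).
by apply/seteqP; split => w /=; [move=> h; split|case].
Qed.

(** For fixed [B0] both sides are finite measures in [A], so agreement on cylinders suffices. *)
Lemma iid_tail_indep (A : set (seqspace R)) (B0 : set R) :
  measurable A -> measurable B0 ->
  P ((seqshift \o Xs) @^-1` A `&` X 0%N @^-1` B0) =
  (P ((seqshift \o Xs) @^-1` A) * P (X 0%N @^-1` B0))%E.
Proof.
move=> mA mB0.
have mE : measurable (X 0%N @^-1` B0).
  by rewrite -[X in measurable X]setTI; exact: mX.
have fE : P (X 0%N @^-1` B0) \is a fin_num by exact: fin_num_measure.
have fE0 : 0 <= fine (P (X 0%N @^-1` B0)) by rewrite fine_ge0.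
rewrite muleC -[X in (X * _)%E]fineK//.
apply: (@eq_measure_cylinders _ (pushmeasure (mrestr P mE) mXs')
  (mscale (NngNum fE0) (pushmeasure P mXs'))) => //.
  rewrite /= /pushforward /mrestr preimage_setT setTI.
  by apply: (le_lt_trans (probability_le1 P mE)); rewrite ltry.
move=> _ [n [B [mB ->]]].
transitivity (P (X 0%N @^-1` B0) * \prod_(i < n) P (X 0%N @^-1` B i))%E.
  rewrite -iid_cons//= /pushforward /mrestr; congr (P _).
  by apply/seteqP; split => w /= [].
rewrite /= /mscale /= fineK//; congr (_ * _)%E.
have := @iid_cons n setT B measurableT mB.
rewrite preimage_setT probability_setT mul1e => <-; congr (P _).
by apply/seteqP; split => w /=; [case|move=> h; split].
Qed.

Hypothesis iX : P.-integrable setT (EFin \o X 0%N).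

Lemma psmax_shift_ge (f : seqspace R -> R) (x : seqspace R) n :
  \sum_(i < n) f (fun j => x (i + j)%N) <= psmax seqshift f n x.
Proof.
elim: n x => [|n IHn] x; first by rewrite big_ord0.
rewrite big_ord_recl /= le_max; apply/orP; right.
rewrite lerD//.
apply: le_trans (IHn _); apply: ler_sum => i _.
by rewrite /seqshift.
Qed.

(** One half of the strong law: applied to [X] and to [- X], it bounds the partial sums on both
    sides, up to a random constant. *)
Lemma iid_partial_sums_bounded (c : R) : Rintegral P setT (X 0%N) < c ->
  {ae P, forall w, exists K : nat, forall n, \sum_(i < n) X i w <= n%:R * c + K%:R}.
Proof.
move=> EXc.
pose f (x : seqspace R) := x 0%N - c.
have icst : P.-integrable setT (EFin \o cst c).
  exact: finite_measure_integrable_cst.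
have iXc : P.-integrable setT (EFin \o (fun w => X 0%N w - c)).
  have := integrableB measurableT iX icst.
  by apply: eq_integrable.
have mf : measurable_fun setT f.
  by apply: measurable_funB => //; exact: measurable_coord.
have mEf : measurable_fun setT (EFin \o f) by exact/measurable_EFinP.
have intf : (pushmeasure P mXs).-integrable setT (EFin \o f).
  by apply: integrable_pushforward.
have mth := @measurable_seqshift R.
have muth A : measurable A -> pushmeasure P mXs (seqshift @^-1` A) = pushmeasure P mXs A.
  by move=> mA; exact: iid_stationary.
pose A := psmax_unbounded seqshift f.
have mA : measurable A := measurable_psmax_unbounded mth intf.
have mE : measurable (Xs @^-1` A).
  by rewrite -[X in measurable X]setTI; exact: mXs.
(* By invariance the event depends on the shifted sequence only, which is independent of [X 0]. *)
have EA : Xs @^-1` A = (seqshift \o Xs) @^-1` A.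
  by rewrite [in LHS]/A -psmax_unbounded_invariant.
have := integral_psmax_unbounded_ge0 mth muth intf.
rewrite integral_pushforward//; last first.
  exact: (integrableS measurableT).
rewrite -/A (_ : (EFin \o f) \o Xs = fun w => (X 0%N w - c)%:E)//.
rewrite integral_indep//; last first.
  move=> B mB; rewrite EA.
  rewrite (_ : _ @^-1` B = X 0%N @^-1` ((fun r => r - c) @^-1` B))//.
  apply: iid_tail_indep => //.
  rewrite -[X in measurable X]setTI.
  have : measurable_fun setT (fun r : R => r - c) by apply: measurable_funB.
  exact.
have -> : (\int[P]_w (X 0%N w - c)%:E = (Rintegral P setT (X 0%N) - c)%:E)%E.
  rewrite integralB_EFin//= integral_cst//.
  rewrite [X in (_ * X)%E](_ : _ = 1%E) ?mule1; last exact: probability_setT.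
  by rewrite EFinB fineK//; exact: integrable_fin_num.
move=> PA0.
have {}PA0 : P (Xs @^-1` A) = 0.
  apply/eqP; rewrite eq_le measure_ge0 andbT.
  rewrite -[leLHS]fineK ?fin_num_measure// lee_fin.
  move: PA0; rewrite -[X in (X * _)%E]fineK ?fin_num_measure// -EFinM lee_fin.
  by rewrite nmulr_lge0 ?subr_lt0.
exists (Xs @^-1` A); split => // w /= /forallNP unb K.
apply: contrapT => /forallNP bnd; apply: (unb K) => n.
have := psmax_shift_ge f (Xs w) n.
have /negP := bnd n; rewrite -leNgt => /[swap] /le_trans /[apply].
rewrite /f /Xs sumrB sumr_const card_ord lerBlDr addrC -[c *+ n]mulr_natl.
by apply: le_trans; apply: ler_sum => i _; rewrite addn0.
Qed.

End iid.

(** The slopes [m + 1/(j+1)] form a countable family, so one null set serves all [j]; division by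
    [n] removes the random constants. *)
Lemma strong_law_large_numbers d (T : measurableType d) (R : realType)
    (P : probability T R) (X : nat -> T -> R) :
  (forall i, measurable_fun setT (X i)) ->
  (forall n (B : nat -> set R), (forall i, measurable (B i)) ->
    P [set w | forall i, (i < n)%N -> B i (X i w)] =
    (\prod_(i < n) P (X 0%N @^-1` B i))%E) ->
  P.-integrable setT (EFin \o X 0%N) ->
  {ae P, forall w,
    (fun n => n%:R^-1 * \sum_(i < n) X i w) @ \oo --> Rintegral P setT (X 0%N)}.
Proof.
move=> mX iid iX.
pose m := Rintegral P setT (X 0%N).
have upper (j : nat) : {ae P, forall w, exists K : nat,
    forall n, \sum_(i < n) X i w <= n%:R * (m + j.+1%:R^-1) + K%:R}.
  by apply: iid_partial_sums_bounded => //; rewrite ltrDl invr_gt0.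
have lower (j : nat) : {ae P, forall w, exists K : nat,
    forall n, \sum_(i < n) - X i w <= n%:R * (- m + j.+1%:R^-1) + K%:R}.
  apply: (@iid_partial_sums_bounded _ _ _ P (fun i w => - X i w)) => //.
  - by move=> i; exact: measurableT_comp.
  - move=> n B mB.
    rewrite -(@iid n (fun i => -%R @^-1` B i))// => i.
    have : measurable_fun setT (-%R : R -> R) by exact: oppr_measurable.
    by move=> /(_ measurableT _ (mB i)); rewrite setTI.
  - exact: (integrableN iX).
  - rewrite (_ : Rintegral P setT _ = - m) ?ltrDl ?invr_gt0//.
    rewrite /m -mulN1r -RintegralZl//; congr Rintegral.
    by apply/funext => w; rewrite mulN1r.
have upper' := ae_foralln upper; have lower' := ae_foralln lower.
apply: filterS2 upper' lower' => w up' lo'; apply/cvgrPdist_le => e e0.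
(* Half of [e] pays for the excess slope, the other half for the random constants [K1] and [K2]. *)
have [j je] : exists j : nat, j.+1%:R^-1 <= e / 2.
  exists (Num.truncn (e / 2)^-1); rewrite invf_ple ?posrE ?divr_gt0//.
  by rewrite ltW// truncnS_gt.
have [K1 up] := up' j; have [K2 lo] := lo' j.
near=> n.
have n0 : (0 : R) < n%:R by rewrite ltr0n; near: n; exact: nbhs_infty_gt.
have Kn : (K1 + K2)%:R <= n%:R * (e / 2).
  rewrite -ler_pdivrMr ?divr_gt0//; near: n; exact: nbhs_infty_ger.
have := lo n; rewrite sumrN => lon; have upn := up n.
have nj : n%:R * j.+1%:R^-1 <= n%:R * (e / 2) :> R by rewrite ler_pM2l.
have K0 : (0 : R) <= K1%:R by [].
have K0' : (0 : R) <= K2%:R by [].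
rewrite natrD in Kn.
have -> : m - n%:R^-1 * \sum_(i < n) X i w = n%:R^-1 * (n%:R * m - \sum_(i < n) X i w).
  by rewrite mulrBr mulrA mulVf ?gt_eqF// mul1r.
rewrite normrM gtr0_norm ?invr_gt0// ler_pdivrMl// ler_norml.
move: lon upn; rewrite !mulrDr => lon upn.
have ee : n%:R * e = n%:R * (e / 2) + n%:R * (e / 2) by rewrite -mulrDr -splitr.
rewrite mulrN in lon.
move: lon upn ee Kn nj K0 K0'.
move: (n%:R * m) (n%:R * j.+1%:R^-1) (n%:R * e) (n%:R * (e / 2)) (\sum_(i < n) X i w).
move: (K1%:R : R) (K2%:R : R) => a1 a2 a3 a4 a5 a6 a7 *.
by apply/andP; split; lra.
Unshelve. all: by end_near. Qed.

(** * Enumeration along an increasing sequence of finite sets *)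

(** The new elements of each stage are appended to the previous list, so every stage is an initial
    segment of one sequence. *)
Lemma exhaustion_enumeration (I : eqType) (x0 : I) (L : nat -> seq I) :
  (forall m, uniq (L m)) -> (forall m, {subset L m <= L m.+1}) ->
  (forall m, (m < size (L m))%N) ->
  exists2 e : nat -> I, injective e &
    forall m, perm_eq [seq e i | i <- iota 0 (size (L m))] (L m).
Proof.
move=> uL sL szL.
pose fix E m := if m is m'.+1 then E m' ++ [seq x <- L m'.+1 | x \notin E m']
  else L 0%N.
have EL m : perm_eq (E m) (L m).
  elim: m => [|m IHm]; first exact: perm_refl.
  apply: uniq_perm => //.
    rewrite cat_uniq (perm_uniq IHm) uL filter_uniq//= andbT.
    by apply/hasPn => x; rewrite mem_filter => /andP[].
  move=> x; rewrite /= mem_cat mem_filter (perm_mem IHm).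
  by case: (boolP (x \in L m)) => //= /sL ->.
have uE m : uniq (E m) by rewrite (perm_uniq (EL m)).
have sE m : size (E m) = size (L m) by exact: perm_size.
have szE k m : (size (E m) <= size (E (k + m)%N))%N.
  by elim: k => [//|k IH]; rewrite addSn /= size_cat (leq_trans IH)// leq_addr.
have prefE m k i : (i < size (E m))%N -> nth x0 (E (k + m)%N) i = nth x0 (E m) i.
  elim: k => [//|k IHk] im; rewrite addSn /= nth_cat -IHk//.
  by rewrite (leq_trans im (szE k m)).
(* [E i] has more than [i] entries, so the default [x0] is never read; as the lists extend each
   other, any later stage gives the same entry. *)
pose e i := nth x0 (E i) i.
have eE m i : (i < size (E m))%N -> e i = nth x0 (E m) i.
  move=> im; have ii : (i < size (E i))%N by rewrite sE szL.
  by have := prefE i m i ii; rewrite /e => <-; rewrite addnC prefE.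
exists e.
  move=> i j eij; pose M := maxn i j.
  have iM : (i < size (E M))%N.
    by rewrite sE (leq_trans _ (szL M))// ltnS leq_maxl.
  have jM : (j < size (E M))%N.
    by rewrite sE (leq_trans _ (szL M))// ltnS leq_maxr.
  by move: eij; rewrite !(eE M)// => /eqP; rewrite nth_uniq// => /eqP.
move=> m; rewrite -sE (_ : [seq e i | i <- _] = E m) ?EL//.
apply: (@eq_from_nth _ x0); rewrite size_map size_iota// => i im.
by rewrite (nth_map 0%N) ?size_iota// nth_iota// add0n (eE m).
Qed.

(** * Volumes of boxes and division into blocks *)

Lemma bernoulli_sub (R : realDomainType) (d : nat) (x : R) : 0 <= x <= 1 ->
  1 - x ^+ d <= d%:R * (1 - x).
Proof.
move=> /andP[x0 x1]; elim: d => [|d IHd]; first by rewrite expr0 subrr mul0r.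
have xd1 : x ^+ d <= 1 by rewrite exprn_ile1.
have xd0 : 0 <= x ^+ d by rewrite exprn_ge0.
rewrite exprS -natr1 mulrDl mul1r.
nra.
Qed.

Lemma volE (R : realType) d n : vol R d n = (2 * n%:R) ^+ d.
Proof. by rewrite /vol natrX natrM. Qed.

Lemma vol_ge0 (R : realType) d n : 0 <= vol R d n.
Proof. exact: ler0n. Qed.

Lemma vol_gt0 (R : realType) d n : (0 < n)%N -> 0 < vol R d n.
Proof. by move=> n0; rewrite volE exprn_gt0// mulr_gt0// ltr0n. Qed.

Lemma volM (R : realType) d a n : vol R d (a * n) = (a ^ d)%:R * vol R d n.
Proof. by rewrite /vol mulnCA expnMn natrM. Qed.

(** The ratio is [(a / n) ^ d], and Bernoulli's inequality makes its distance to [1] linear in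
    [n - a]; volumes at bounded distance are thus asymptotically equal. *)
Lemma vol_ratio (R : realType) d a n : (0 < n)%N -> (a <= n)%N ->
  0 <= 1 - vol R d a / vol R d n <= d%:R * (n - a)%:R / n%:R.
Proof.
move=> n0 an.
have nR : (0 : R) < n%:R by rewrite ltr0n.
have -> : vol R d a / vol R d n = (a%:R / n%:R) ^+ d.
  by rewrite !volE -expr_div_n -mulf_div divff ?mul1r ?pnatr_eq0.
have x01 : 0 <= (a%:R / n%:R : R) <= 1.
  apply/andP; split; first exact: divr_ge0.
  by rewrite ler_pdivrMr// mul1r ler_nat.
have /andP[x0 x1] := x01.
rewrite subr_ge0 exprn_ile1//=.
apply: (le_trans (@bernoulli_sub R d _ x01)).
rewrite natrB// -mulrA.
by rewrite mulrBl divff ?gt_eqF.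
Qed.

Lemma near_divr_le (R : realType) (c e : R) : 0 < e ->
  \forall n \near \oo, (0 < n)%N /\ c / n%:R <= e.
Proof.
move=> e0; near=> n.
have n0 : (0 < n)%N by near: n; exact: nbhs_infty_gt.
split => //; rewrite ler_pdivrMr ?ltr0n// mulrC -ler_pdivrMr//.
by near: n; exact: nbhs_infty_ger.
Unshelve. all: by end_near. Qed.

(** These blocks have length [2 * k] and tile the integers from [k] on, so [m] is the quotient of
    [n - k] by [2 * k]. *)
Lemma odd_block (k n : nat) : (0 < k)%N -> (k <= n)%N ->
  exists m, ((2 * m + 1) * k <= n < (2 * m + 3) * k)%N.
Proof.
move=> k0 kn; exists ((n - k) %/ (2 * k))%N.
have := divn_eq (n - k) (2 * k); have : ((n - k) %% (2 * k) < 2 * k)%N.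
  by rewrite ltn_mod muln_gt0.
nia.
Qed.

(** * The deterministic limit argument for scalar sequences *)

Section near_additive_sequence.
(** At a fixed outcome and for a fixed coordinate, [s] stands for the process, [b k m] for the sum
    over the box of radius [m] of the copies at scale [k], and [e] for the means. *)
Context (R : realType) (d r : nat) (s e : nat -> R) (b : nat -> nat -> R).
Hypothesis d0 : (0 < d)%N.
Hypothesis additive : forall eps : R, 0 < eps -> \forall k \near \oo,
  forall m, (0 < m)%N ->
    (vol R d ((2 * m + 1) * k))^-1 * `|s ((2 * m + 1) * k)%N - b (k - r)%N m| <= eps.
Hypothesis regular : forall k, (0 < k)%N -> forall eps : R, 0 < eps ->
  \forall n \near \oo, forall m, ((2 * m + 1) * k <= n < (2 * m + 3) * k)%N ->
    (vol R d n)^-1 * `|s n - s ((2 * m + 1) * k)%N| <= eps.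
Hypothesis lln : forall k,
  (fun m => (((2 * m + 1) ^ d)%:R)^-1 * b k m) @ \oo --> e k.

Lemma subsequence_close (eps : R) : 0 < eps -> \forall k \near \oo,
  (0 < k)%N /\ \forall m \near \oo,
    `|s ((2 * m + 1) * k)%N / vol R d ((2 * m + 1) * k) - e (k - r) / vol R d k| <= eps.
Proof.
move=> eps0; have e2 : 0 < eps / 2 by rewrite divr_gt0.
near=> k; have k0 : (0 < k)%N by near: k; exact: nbhs_infty_gt.
have vk : 0 < vol R d k by exact: vol_gt0.
split => //.
have addk : forall m, (0 < m)%N ->
    (vol R d ((2 * m + 1) * k))^-1 * `|s ((2 * m + 1) * k)%N - b (k - r)%N m| <= eps / 2.
  by near: k; exact: additive.
near=> m; have m0 : (0 < m)%N by near: m; exact: nbhs_infty_gt.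
have := addk m m0; set N := ((2 * m + 1) * k)%N => sb.
have vN : 0 < vol R d N by apply: vol_gt0; rewrite muln_gt0 k0 andbT addn1.
have be : `|b (k - r)%N m / vol R d N - e (k - r)%N / vol R d k| <= eps / 2.
  (* As [vol N = (2m+1)^d * vol k], the quotient is the box average over [vol k]; the law of large
     numbers is used with tolerance [eps / 2 * vol k]. *)
  rewrite /N volM invfM mulrCA mulrA -mulrBl normrM normfV (gtr0_norm vk).
  rewrite ler_pdivrMr// distrC; near: m.
  by have /cvgrPdist_le := @lln (k - r)%N; apply; rewrite mulr_gt0.
rewrite (le_trans (ler_distD (b (k - r)%N m / vol R d N) _ _))// [leRHS]splitr.
rewrite lerD// -mulrBl normrM normfV (gtr0_norm vN) mulrC.
exact: sb.
Unshelve. all: by end_near. Qed.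

(** Three errors of [eps / 3]: regularity from [n] down to [N = (2m+1)k], the change of
    normalisation from [vol n] to [vol N], and closeness along the subsequence. *)
Lemma sequence_close (eps : R) : 0 < eps -> \forall k \near \oo,
  \forall n \near \oo, `|s n / vol R d n - e (k - r) / vol R d k| <= eps.
Proof.
move=> eps0; have e3 : 0 < eps / 3 by rewrite divr_gt0.
near=> k.
have [k0 [M _ subk]] : (0 < k)%N /\ \forall m \near \oo,
    `|s ((2 * m + 1) * k)%N / vol R d ((2 * m + 1) * k) - e (k - r)%N / vol R d k| <= eps / 3.
  by near: k; exact: subsequence_close.
set a := e (k - r)%N / vol R d k in subk *.
(* Chosen so that [delta] times the bound [|a| + eps / 3] on [|x|] is [eps / 3]. *)
pose delta := eps / 3 / (`|a| + eps / 3).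
have ae0 : 0 < `|a| + eps / 3 by rewrite ltr_wpDl.
have delta0 : 0 < delta by rewrite divr_gt0.
near=> n.
have regn : forall m, ((2 * m + 1) * k <= n < (2 * m + 3) * k)%N ->
    (vol R d n)^-1 * `|s n - s ((2 * m + 1) * k)%N| <= eps / 3.
  by near: n; exact: regular.
(* This forces the block index [m] of [n] to be at least [M]. *)
have kMn : ((2 * M + 3) * k <= n)%N by near: n; exact: nbhs_infty_ge.
have [n0 ndelta] : (0 < n)%N /\ (d%:R * (2 * k)%:R) / n%:R <= delta.
  by near: n; exact: near_divr_le.
have [m mn] : exists m, ((2 * m + 1) * k <= n < (2 * m + 3) * k)%N.
  by apply: odd_block => //; apply: leq_trans kMn; rewrite leq_pmull// addn3.
have Mm : (M <= m)%N by nia.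
have := subk m Mm; set N := ((2 * m + 1) * k)%N in mn *.
set x := s N / vol R d N => xa.
have vn : 0 < vol R d n by exact: vol_gt0.
have N0 : (0 < N)%N by rewrite muln_gt0 k0 andbT addn1.
have vN : 0 < vol R d N by exact: vol_gt0.
have Nn : (N <= n)%N by case/andP: mn.
have /andP[rho0 rho1] := vol_ratio R d n0 Nn.
set rho := vol R d N / vol R d n in rho0 rho1.
(* Within a block [n - N] is at most [2 * k], which is negligible against [n]. *)
have rhod : 1 - rho <= delta.
  apply: (le_trans rho1); apply: le_trans ndelta.
  rewrite ler_pM2r ?invr_gt0 ?ltr0n// ler_wpM2l// ler_nat.
  by rewrite leq_subLR; case/andP: mn; rewrite /N; nia.
have snx : `|s n / vol R d n - x * rho| <= eps / 3.
  rewrite /x /rho mulrA divfK ?gt_eqF// -mulrBl normrM normfV (gtr0_norm vn) mulrC.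
  exact: regn.
have xx : `|x * rho - x| <= eps / 3.
  have -> : x * rho - x = - (x * (1 - rho)) by ring.
  rewrite normrN normrM (ger0_norm rho0).
  apply: (@le_trans _ _ ((`|a| + eps / 3) * delta)); last first.
    by rewrite /delta mulrC divfK// gt_eqF.
  apply: ler_pM => //.
  by rewrite -[x](subrK a) addrC (le_trans (ler_normD _ _))// lerD2l.
rewrite (le_trans (ler_distD (x * rho) _ _))//.
have -> : eps = eps / 3 + (eps / 3 + eps / 3) by lra.
rewrite lerD//.
by rewrite (le_trans (ler_distD x _ _))// lerD.
Unshelve. all: by end_near. Qed.

Lemma rescaled_limit : exists L : R,
  (fun n => s n / vol R d n) @ \oo --> L /\ (fun n => e n / vol R d n) @ \oo --> L.
Proof.
have cv : cvg ((fun n => s n / vol R d n) @ \oo).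
  (* It suffices that, for each [eps], the sequence eventually stays in some ball of radius [eps]; a
     rescaled mean serves as centre. *)
  apply/cauchy_cvgP/cauchy_exP => eps eps0.
  have [|K _ closeK] := @sequence_close (eps / 2); first by rewrite divr_gt0.
  exists (e (K - r)%N / vol R d K).
  have := closeK K (leqnn K); apply: filterS => n.
  rewrite -ball_normE /ball_ /= distrC => /le_lt_trans; apply.
  by rewrite ltr_pdivrMr// ltr_pMr// ltr1n.
exists (lim ((fun n => s n / vol R d n) @ \oo)); split => //.
set L := lim _ in cv *.
have eL : (fun k => e (k - r)%N / vol R d k) @ \oo --> L.
  apply/cvgrPdist_le => eps eps0; have e2 : 0 < eps / 2 by rewrite divr_gt0.
  near=> k.
  have : \forall n \near \oo, `|s n / vol R d n - e (k - r)%N / vol R d k| <= eps / 2.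
    by near: k; exact: sequence_close.
  move/cvgrPdist_le : cv => /(_ _ e2) sL sk.
  have [n [? ?]] := filter_ex (filterI sL sk).
  rewrite (le_trans (ler_distD (s n / vol R d n) _ _))// [leRHS]splitr.
  by rewrite lerD.
(* The means carry the lag [r]: reindexing by [k = n + r] gives the limit of [e n / vol (n + r)],
   and this ratio restores the normalisation [vol n]. *)
have rho : (fun n => vol R d n / vol R d (n + r)) @ \oo --> (1 : R).
  apply/cvgrPdist_le => eps eps0; near=> n.
  have [n0 nr] : (0 < n)%N /\ (d%:R * r%:R) / n%:R <= eps.
    by near: n; exact: near_divr_le.
  have nr0 : (0 < n + r)%N by rewrite addn_gt0 n0.
  have /andP[h0 h1] := vol_ratio R d nr0 (leq_addr r n).
  rewrite ger0_norm// (le_trans h1)// (le_trans _ nr)// addKn.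
  by rewrite ler_wpM2l// ?mulr_ge0// lef_pV2 ?posrE ?ltr0n// ler_nat leq_addr.
have eL' : (fun n => e n / vol R d (n + r)) @ \oo --> L.
  have := cvg_comp _ _ (@cvg_addnr r) eL.
  by apply: cvg_trans; apply: near_eq_cvg; near=> n; rewrite /= addnK.
rewrite -[L]mulr1 -[X in L * X]invr1.
have : (fun n => e n / vol R d (n + r) * (vol R d n / vol R d (n + r))^-1) @ \oo -->
    L * 1^-1 by exact: (cvgM eL' (cvgV (oner_neq0 _) rho)).
apply: cvg_trans; apply: near_eq_cvg; near=> n.
have n0 : (0 < n)%N by near: n; exact: nbhs_infty_gt.
rewrite /= invf_div mulrA divfK// gt_eqF// vol_gt0// addn_gt0 n0//.
Unshelve. all: by end_near. Qed.

End near_additive_sequence.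

(** * Euclidean norm and coordinates *)

Lemma enorm_coord_le (R : realType) h (v : 'rV[R]_h) i : `|v ord0 i| <= enorm v.
Proof.
rewrite /enorm -sqrtr_sqr ler_sqrt; last by apply: sumr_ge0 => j _; rewrite sqr_ge0.
by rewrite (bigD1 i)//= lerDl sumr_ge0// => j _; rewrite sqr_ge0.
Qed.

Lemma cvg_enorm0 (R : realType) h (u : nat -> 'rV[R]_h) (l : 'rV[R]_h) :
  (forall i, (fun n => u n ord0 i) @ \oo --> l ord0 i) ->
  (fun n => enorm (u n - l)) @ \oo --> (0 : R).
Proof.
move=> ul.
have sq0 : (fun n => \sum_(i < h) (u n - l) ord0 i ^+ 2) @ \oo -->
    \sum_(i < h) (l ord0 i - l ord0 i) ^+ 2.
  apply: cvg_big => [|i _]; first exact: add_continuous.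
  under eq_fun do rewrite !mxE expr2.
  by rewrite expr2; apply: cvgM; apply: cvgB => //; exact: cvg_cst.
have {}sq0 : (fun n => \sum_(i < h) (u n - l) ord0 i ^+ 2) @ \oo --> (0 : R).
  by move: sq0; rewrite [X in _ --> X]big1// => i _; rewrite subrr expr0n.
have := continuous_cvg _ (@sqrt_continuous R 0) sq0.
by rewrite sqrtr0; exact.
Qed.

(** * Lattice boxes and the law of large numbers over them *)

(** The points indexing [box_sum] as a list, the form required for enumerating an exhaustion. *)
Definition box (d m : nat) : seq (latt d) :=
  [seq [ffun i => (nat_of_ord (t i))%:Z - m%:Z] | t : {ffun 'I_d -> 'I_(2 * m + 1)}].

Lemma box_uniq d m : uniq (box d m).
Proof.
rewrite map_inj_uniq ?enum_uniq// => t u /ffunP tu; apply/ffunP => i.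
by have := tu i; rewrite !ffunE => /addIr [] /val_inj.
Qed.

Lemma size_box d m : size (box d m) = ((2 * m + 1) ^ d)%N.
Proof. by rewrite size_map -cardE card_ffun !card_ord. Qed.

Lemma box_sumE (R : realType) h d m (F : latt d -> 'rV[R]_h) :
  box_sum m F = \sum_(z <- box d m) F z.
Proof. by rewrite /box_sum big_image. Qed.

Lemma box_subset d m : {subset box d m <= box d m.+1}.
Proof.
move=> z /mapP[t _ ->]; apply/mapP.
(* Recentring from [m] to [m.+1] raises each offset by one. *)
have lt1 (i : 'I_d) : (t i + 1 < 2 * m.+1 + 1)%N by have := ltn_ord (t i); lia.
exists [ffun i => Ordinal (lt1 i)]; first by rewrite mem_enum.
by apply/ffunP => i; rewrite !ffunE /=; lia.
Qed.

(** A single enumeration serves all [m], turning box sums into partial sums of one sequence; [0 < d]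
    makes the boxes grow fast enough for the exhaustion. *)
Lemma lattice_enumeration d : (0 < d)%N ->
  exists2 e : nat -> latt d, injective e &
    forall (R : realType) h m (F : latt d -> 'rV[R]_h),
      box_sum m F = \sum_(i < (2 * m + 1) ^ d) F (e i).
Proof.
move=> d0.
have [|e e_inj eL] := @exhaustion_enumeration (latt d) [ffun=> 0] _ (@box_uniq d) (@box_subset d).
  move=> m; rewrite size_box; apply: (@leq_trans ((2 * m + 1) ^ 1)); first lia.
  by rewrite leq_pexp2l// addn1.
exists e => // R h m F.
rewrite box_sumE -(perm_big _ (eL m))/= size_box big_map -{1}[(_ ^ d)%N]subn0.
by rewrite -/(index_iota _ _) big_mkord.
Qed.

Lemma borel_cylinder (R : realType) h (c : 'I_h) (B : set R) :
  measurable B -> borel_vec [set v : 'rV[R]_h | B (v ord0 c)].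
Proof. by move=> mB; apply: sub_sigma_algebra; exists c, B. Qed.

(** Along the enumeration, the coordinates form an i.i.d. sequence whose averages are read at the
    indices [(2m+1)^d]; integrability and mean pass from [Y] through equality of laws. *)
Lemma box_law_large_numbers (d h : nat) dm (T : measurableType dm) (R : realType)
    (P : probability T R) (Y : T -> 'rV[R]_h) (Z : latt d -> T -> 'rV[R]_h) (c : 'I_h) :
  (0 < d)%N -> random_vec Y -> integrable_vec P Y ->
  (forall z, random_vec (Z z)) -> indep_vecs P Z -> (forall z, same_law P (Z z) Y) ->
  {ae P, forall w, (fun m => (((2 * m + 1) ^ d)%:R)^-1 *
     (box_sum m (fun z => Z z w)) ord0 c) @ \oo --> expect P Y ord0 c}.
Proof.
move=> d0 rY iY rZ indepZ lawZ.
have [e e_inj boxE] := lattice_enumeration d0.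
pose X i w := Z (e i) w ord0 c.
have lawX i B : measurable B -> P (X i @^-1` B) = P ((fun w => Y w ord0 c) @^-1` B).
  by move=> mB; exact: (lawZ _ _ (borel_cylinder c mB)).
have mX i : measurable_fun setT (X i) by exact: rZ.
have mY : measurable_fun setT (fun w => Y w ord0 c) by exact: rY.
have pushE : forall A, measurable A -> pushmeasure P (mX 0%N) A = pushmeasure P mY A.
  by move=> A mA; exact: lawX.
have iX : P.-integrable setT (EFin \o X 0%N).
  apply/integrableP; split; first exact/measurable_EFinP.
  have /integrableP[_] := iY c; apply: le_lt_trans.
  have ma : measurable_fun setT (fun x : R => `|x%:E|%E).
    by apply: measurableT_comp => //; exact: (@EFin_measurable R setT).
  rewrite -(@ge0_integral_pushforward _ _ _ _ _ _ (mX 0%N) P setT (fun x => `|x%:E|%E))//.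
  rewrite -(@ge0_integral_pushforward _ _ _ _ _ _ mY P setT (fun x => `|x%:E|%E))//.
  rewrite le_eqVlt; apply/orP; left; apply/eqP.
  by apply: (@eq_measure_integral _ _ _ _ (pushmeasure P mY) (pushmeasure P (mX 0%N))) => A mA _; exact: lawX.
have EX : Rintegral P setT (X 0%N) = expect P Y ord0 c.
  rewrite mxE; congr fine.
  have mE : measurable_fun setT (@EFin R) by exact: (@EFin_measurable R setT).
  rewrite -(@integral_pushforward _ _ _ _ _ _ (mX 0%N) P setT EFin)//.
  rewrite -(@integral_pushforward _ _ _ _ _ _ mY P setT EFin)//; last exact: iY.
  by apply: (@eq_measure_integral _ _ _ _ (pushmeasure P mY) (pushmeasure P (mX 0%N))) => A mA _; exact: lawX.
have iid n (B : nat -> set R) : (forall i, measurable (B i)) ->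
    P [set w | forall i, (i < n)%N -> B i (X i w)] =
    (\prod_(i < n) P (X 0%N @^-1` B i))%E.
  move=> mB; pose J := [seq e i | i <- iota 0 n].
  (* Independence takes sets indexed by lattice points; injectivity of [e] lets the position of [z]
     in [J] recover the index of its set. *)
  pose C z := [set v : 'rV[R]_h | B (index z J) (v ord0 c)].
  have idx i : (i < n)%N -> index (e i) J = i.
    move=> ni; rewrite index_map//.
    have := @index_uniq _ 0%N i (iota 0 n).
    by rewrite size_iota nth_iota// add0n => ->//; exact: iota_uniq.
  have uJ : uniq J by rewrite map_inj_uniq// iota_uniq.
  have bC z : borel_vec (C z) by exact: borel_cylinder.
  have := indepZ J C uJ bC.
  rewrite big_map -[X in iota _ X]subn0 -/(index_iota 0 n) big_mkord => indJ.
  transitivity (\prod_(i < n) P (Z (e i) @^-1` C (e i)))%E; last first.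
    by apply: eq_bigr => i _; rewrite /C idx//= lawX// -(lawX i).
  rewrite -indJ; congr (P _); apply/seteqP; split => w /=.
    move=> Bw z /= /mapP[i]; rewrite mem_iota add0n /= => ni ->.
    by rewrite /C /= idx//; exact: Bw.
  move=> Cw i ni; have := Cw (e i); rewrite /C /= idx//; apply.
  by apply/mapP; exists i; rewrite // mem_iota.
have := strong_law_large_numbers mX iid iX; rewrite EX.
apply: filterS => w slln.
have sub : (fun m => (2 * m + 1) ^ d)%N @ \oo --> \oo.
  apply/cvgnyPge => A; near=> m.
  apply: (@leq_trans m); first by near: m; exact: nbhs_infty_ge.
  apply: (@leq_trans ((2 * m + 1) ^ 1)); first lia.
  by rewrite leq_pexp2l// addn1.
have := cvg_comp _ _ sub slln; apply: cvg_trans; apply: near_eq_cvg; near=> m.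
by rewrite /= boxE summxE.
Unshelve. all: by end_near. Qed.

(** * Assembly of the almost sure limits *)

(** Each coordinate is bounded by the norm, so near additivity and regularity descend to coordinates
    and the scalar case applies. *)
Lemma rescaled_coord_limit (R : realType) (d h r : nat)
    (s e : nat -> 'rV[R]_h) (b : nat -> nat -> 'rV[R]_h) (c : 'I_h) : (0 < d)%N ->
  (forall eps : R, 0 < eps -> \forall k \near \oo, forall m, (0 < m)%N ->
    (vol R d ((2 * m + 1) * k))^-1 *
      enorm (s ((2 * m + 1) * k)%N - b (k - r)%N m) <= eps) ->
  (forall k, (0 < k)%N -> forall eps : R, 0 < eps ->
    \forall n \near \oo, forall m, ((2 * m + 1) * k <= n < (2 * m + 3) * k)%N ->
      (vol R d n)^-1 * enorm (s n - s ((2 * m + 1) * k)%N) <= eps) ->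
  (forall k, (fun m => (((2 * m + 1) ^ d)%:R)^-1 * b k m ord0 c) @ \oo --> e k ord0 c) ->
  exists L : R, (fun n => ((vol R d n)^-1 *: s n) ord0 c) @ \oo --> L /\
    (fun n => ((vol R d n)^-1 *: e n) ord0 c) @ \oo --> L.
Proof.
move=> d0 additive regular lln.
have coordE (u : nat -> 'rV[R]_h) :
    (fun n => ((vol R d n)^-1 *: u n) ord0 c) = (fun n => u n ord0 c / vol R d n).
  by apply/funext => n; rewrite mxE mulrC.
have coord_le v a n : (vol R d n)^-1 * enorm v <= a -> (vol R d n)^-1 * `|v ord0 c| <= a.
  by apply: le_trans; rewrite ler_wpM2l ?invr_ge0 ?vol_ge0// enorm_coord_le.
rewrite !coordE.
apply: (@rescaled_limit R d r _ _ (fun k m => b k m ord0 c)) => //.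
- move=> eps /additive; apply: filterS => k H m m0.
  by have /coord_le := H m m0; rewrite !mxE.
- move=> k k0 eps /(regular k k0); apply: filterS => n H m mn.
  by have /coord_le := H m mn; rewrite !mxE.
Qed.

Unset Implicit Arguments.

Theorem mainTheorem15 (d h : nat) (dm : measure_display) (T : measurableType dm)
  (R : realType) (P : probability T R) (S : nat -> T -> 'rV[R]_h) :
  (0 < d)%N -> (0 < h)%N ->
  (forall n, random_vec (S n)) ->
  (forall n, integrable_vec P (S n)) ->
  strongly_regular P d S ->
  strongly_nearly_additive P d S ->
  (exists M : R, forall n : nat, (0 < n)%N ->
      enorm (expect P (S n)) / vol R d n <= M) ->
  exists Shat : 'rV[R]_h,
    (fun n => enorm ((vol R d n)^-1 *: expect P (S n) - Shat)) @ \oo --> (0 : R)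
    /\ {ae P, forall w,
          (fun n => enorm ((vol R d n)^-1 *: S n w - Shat)) @ \oo --> (0 : R)}.
Proof.
move=> d0 _ rS iS regular [r [Z [rZ [indepZ [lawZ additive]]]]] _.
have regular_ae : {ae P, forall w, forall k, (0 < k)%N -> forall eps : R, 0 < eps ->
    \forall n \near \oo, forall m, ((2 * m + 1) * k <= n < (2 * m + 3) * k)%N ->
      (vol R d n)^-1 * enorm (S n w - S ((2 * m + 1) * k)%N w) <= eps}.
  (* Countably many null sets, one for each [k], are merged; the case [k = 0] is vacuous. *)
  apply: ae_foralln => -[|k]; first by apply: aeW.
  by have := regular k.+1 isT; apply: filterS => w H _.
have lln_ae : {ae P, forall w, forall k c,
    (fun m => (((2 * m + 1) ^ d)%:R)^-1 * (box_sum m (fun z => Z k z w)) ord0 c) @ \oo -->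
      expect P (S k) ord0 c}.
  apply: ae_foralln => k; apply: filter_forall => c.
  exact: box_law_large_numbers.
have limit_ae : {ae P, forall w, forall c, exists L : R,
    (fun n => ((vol R d n)^-1 *: S n w) ord0 c) @ \oo --> L /\
    (fun n => ((vol R d n)^-1 *: expect P (S n)) ord0 c) @ \oo --> L}.
  apply: filterS3 additive regular_ae lln_ae => w addw regw llnw c.
  by apply: (@rescaled_coord_limit _ _ _ r _ _ (fun k m => box_sum m (fun z => Z k z w))).
(* Defined from the means alone, so that the same vector serves every outcome. *)
pose Shat : 'rV[R]_h :=
  \row_c lim ((fun n => ((vol R d n)^-1 *: expect P (S n)) ord0 c) @ \oo).
have ShatE (c : 'I_h) (L : R) :
    (fun n => ((vol R d n)^-1 *: expect P (S n)) ord0 c) @ \oo --> L -> Shat ord0 c = L.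
  by move=> eL; rewrite mxE; exact/cvg_lim.
exists Shat; split.
  (* Convergence of the means does not involve the outcome, so one good outcome suffices; it exists
     because [P] has total mass one. *)
  have [w limw] : exists w, forall c, exists L : R,
      (fun n => ((vol R d n)^-1 *: S n w) ord0 c) @ \oo --> L /\
      (fun n => ((vol R d n)^-1 *: expect P (S n)) ord0 c) @ \oo --> L.
    apply: contrapT => /forallNP none; case: limit_ae => N [mN N0 sub].
    have : P setT = 0.
      by apply/eqP; rewrite -measure_le0 -N0 le_measure ?inE// => w _; apply: sub; exact: none.
    by rewrite probability_setT => /eqP; rewrite onee_eq0.
  by apply: cvg_enorm0 => c; have [L [_ eL]] := limw c; rewrite (ShatE c L).
apply: filterS limit_ae => w limw; apply: cvg_enorm0 => c.
by have [L [sL eL]] := limw c; rewrite (ShatE c L).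
Qed.
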